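(* Let $D$ be a complete division ring of characteristic $0$. If a function $y:D\to D$ is a solution of the differential equation $$\partial(y)(h)=\frac12(yh+hy),$$ then the Gâteaux derivative of order $n$ of $y$ has the form $$\partial^n(y)(h_1;\dots;h_n)=\frac1{2^n}\sum_{\sigma}\sigma(y)\,\sigma(h_1)\cdots\sigma(h_n),$$ where the sum is over those permutations $$\sigma=\begin{pmatrix}y&h_1&\dots&h_n\\ \sigma(y)&\sigma(h_1)&\dots&\sigma(h_n)\end{pmatrix}$$ of the variables $y,h_1,\dots,h_n$ which have the following properties: (1) if there exist $i\ne j$ such that $h_i$ is situated in the product $\sigma(y)\sigma(h_1)\cdots\sigma(h_n)$ to the left of $h_j$ and $h_j$ is situated to the left of $y$, then $i<j$; (2) if there exist $i\ne j$ such that $h_i$ is situated in the product $\sigma(y)\sigma(h_1)\cdots\sigma(h_n)$ to the right of $h_j$ and $h_j$ is situated to the right of $y$, then $i<j$.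
   Context: A complete division ring of characteristic $0$ is a division ring $D$ of characteristic $0$ with an absolute value $|\cdot|:D\to\mathbb R$ ($|a|\ge0$, $|a|=0$ iff $a=0$, $|ab|=|a||b|$, $|a+b|\le|a|+|b|$), complete for the metric $|a-b|$, such that the embedding of the rational field $\mathbb Q$ (usual topology) into $D$ is a homeomorphism onto its image; then $\mathbb R$ is a subfield of the center $Z(D)$. A map $f:D\to D$ is differentiable in the Gâteaux sense if at every $x$ one has $f(x+a)-f(x)=\partial f(x)(a)+o(a)$, where $a\mapsto\partial f(x)(a)$ is linear (additive and homogeneous over $Z(D)$) and $o$ is a continuous map with $|o(a)|/|a|\to0$ as $a\to0$; then $\partial f(x)(a)=\lim_{t\to0,\,t\in\mathbb R}t^{-1}(f(x+ta)-f(x))$. Higher derivatives: $\partial^nf(x)(h_1;\dots;h_n)=\partial\big(\partial^{n-1}f(x)(h_1;\dots;h_{n-1})\big)(h_n)$, the outer $\partial$ being taken with respect to $x$. The differential equation means $\partial y(x)(h)=\frac12(y(x)h+hy(x))$ for all $x,h\in D$. Permutations are permutations of the $n+1$ formal symbols $y,h_1,\dots,h_n$: $\sigma$ rearranges the tuple $(y,h_1,\dots,h_n)$ into $(\sigma(y),\sigma(h_1),\dots,\sigma(h_n))$, and the position of a symbol is its place in the rearranged tuple; in the product each symbol is replaced by the corresponding element of $D$ ($y$ by $y(x)$). *)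

(* Defs.v *)
From HB Require Import structures.
From mathcomp Require Import all_boot all_order all_algebra all_fingroup.
From mathcomp Require Import all_classical all_reals all_analysis.

Set Implicit Arguments.
Unset Strict Implicit.
Unset Printing Implicit Defensive.

Import Order.TTheory GRing.Theory Num.Theory.
Import numFieldNormedType.Exports.

Local Open Scope classical_set_scope.
Local Open Scope ring_scope.

(* The absolute value is not the norm of a normedZmodType: the latter satisfies
   `|x *+ n| = `|x| *+ n, whereas here abs n%:R may be, e.g., Num.sqrt n%:R.
   By abs_entourageE the uniform structure, hence the topology, of D is that of
   the metric abs (a - b). *)
HB.mixin Record isCompleteDivRing (R : realType) D
    & GRing.UnitRing D & Uniform D := {
  divring_unit : forall a : D, a != 0 -> a \is a GRing.unit;
  divring_pchar0 : [pchar D] =i pred0;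
  abs : D -> R;
  abs_ge0 : forall a, 0 <= abs a;
  abs_eq0 : forall a, abs a = 0 <-> a = 0;
  absM : forall a b, abs (a * b) = abs a * abs b;
  abs_leD : forall a b, abs (a + b) <= abs a + abs b;
  abs_entourageE :
    @entourage D = entourage_ (fun (a : D) (e : R) => [set b | abs (a - b) < e]);
  abs_complete : forall F : set_system D,
    ProperFilter F -> cauchy F -> exists l : D, F --> l;
  (* ratr is a homeomorphism from rat, with its usual topology, onto its image *)
  ratr_homeo : exists g : D -> rat^o,
    [/\ cancel (ratr : rat^o -> D) g,
        continuous (ratr : rat^o -> D) &
        {within range (ratr : rat^o -> D), continuous g}] }.

#[short(type="completeDivRingType")]
HB.structure Definition CompleteDivRing (R : realType) :=
  {D of GRing.UnitRing D & Uniform D & isCompleteDivRing R D}.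

Section Gateaux.
Context {R : realType} {D : completeDivRingType R}.
Implicit Types (f L o : D -> D) (x a c z : D).

Definition center_linear L : Prop :=
  {morph L : a b / a + b} /\
  forall c a, (forall z, GRing.comm c z) -> L (c * a) = c * L a.

Definition is_gateaux f x L : Prop :=
  center_linear L /\
  exists o, [/\ continuous o,
    (abs (o a) / abs a : R) @[a --> (0 : D)^'] --> (0 : R) &
    forall a, f (x + a) - f x = L a + o a].

Definition gateaux_differentiable f : Prop :=
  forall x, exists L, is_gateaux f x L.

(* junk value 0 when f is not differentiable at x *)
Definition gateaux f x : D -> D := xget (fun=> 0) [set L | is_gateaux f x L].

(* gateauxn f [:: h_1; ...; h_n] x is the derivative of order n of f at x,
   evaluated at h_1; ...; h_n *)
Definition gateauxn f (h : seq D) : D -> D :=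
  foldl (fun g a => fun x => gateaux g x a) f h.

Definition gateaux_differentiablen (n : nat) f : Prop :=
  forall h : seq D, (size h < n)%N -> gateaux_differentiable (gateauxn f h).

End Gateaux.

(* The symbols y, h_1, ..., h_n are the elements of 'I_n.+1: ord0 is y, and
   lift ord0 i is h_(i+1) for i : 'I_n. The rearranged tuple has the symbol
   s k at place k, so that a symbol u is at place s^-1 u. *)
Section Symbols.
Variable n : nat.
Implicit Types (s : 'S_n.+1) (u v : 'I_n.+1).

Definition sym_y : 'I_n.+1 := ord0.
Definition sym_h (i : 'I_n) : 'I_n.+1 := lift ord0 i.

Definition left_of s u v : bool := ((s^-1)%g u < (s^-1)%g v)%N.

Definition left_ordered s : bool :=
  [forall i : 'I_n, forall j : 'I_n,
    [&& i != j, left_of s (sym_h i) (sym_h j) & left_of s (sym_h j) sym_y]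
      ==> (i < j)%N].

Definition right_ordered s : bool :=
  [forall i : 'I_n, forall j : 'I_n,
    [&& i != j, left_of s (sym_h j) (sym_h i) & left_of s sym_y (sym_h j)]
      ==> (i < j)%N].

Definition sym_val (T : Type) (y : T) (h : n.-tuple T) u : T :=
  if unlift sym_y u is Some i then tnth h i else y.

End Symbols.

(* Main.v *)
Require Import Defs.
From HB Require Import structures.
From mathcomp Require Import all_boot all_order all_algebra all_fingroup.
From mathcomp Require Import all_classical all_reals all_analysis.
From mathcomp Require Import ring.

(** Write [J_a z] for the Jordan product [(z a + a z) / 2], so that the equation
reads [y'(x)(a) = J_a (y x)].  For fixed [h_1], ..., [h_n] the operator
[K = J_{h_1} \o ... \o J_{h_n}] is bounded and linear over the center, hence
differentiating [K \o y] only differentiates [y]: the derivative of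
[x |-> K (y x)] along [a] is [K (J_a (y x))].  By induction on [n],
[[
  d^n y (x) (h_1; ...; h_n) = J_{h_1} (J_{h_2} (... (J_{h_n} (y x)))),
]]
which is [gateauxn_foldr_jordan].  The induction computes with the chosen value
[gateaux f x], so it needs derivatives to be unique ([is_gateaux_unique]): the
difference of two candidates is linear over the center and is [o(a)], and it
vanishes because [D] has nonzero central scalars of arbitrarily small absolute
value, namely the small rationals.

It remains to expand the nested product.  Each [J_{h_i}] puts [h_i] at one of
the two ends of the product already formed around [y], starting with [h_n]
next to [y] and finishing with [h_1] outermost.  So the words that arise are
those whose indices increase from the left end to [y], and from the right end
to [y], which is what conditions (1) and (2) say.  Formally
([sum_nested_recl]), in an admissible permutation [h_1] is at the first or the
last place; removing it is a bijection onto the admissible permutations of the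
remaining symbols, and this matches [a z + z a] with [a = h_1]. *)

Set Implicit Arguments.
Unset Strict Implicit.
Unset Printing Implicit Defensive.

Import Order.TTheory GRing.Theory Num.Theory.
Import numFieldNormedType.Exports.
Local Open Scope classical_set_scope.
Local Open Scope ring_scope.

(** * Absolute value and uniqueness of the derivative *)

Section AbsoluteValue.
Context {R : realType} {D : completeDivRingType R}.
Implicit Types (a b c x z : D) (f K L : D -> D).

Lemma abs0 : abs (0 : D) = 0 :> R.
Proof. exact/abs_eq0. Qed.

Lemma abs_gt0 a : a != 0 -> 0 < abs a :> R.
Proof.
move=> a0; rewrite lt0r abs_ge0 andbT; apply: contra_neq a0.
by move/abs_eq0.
Qed.

Lemma absN a : abs (- a) = abs a :> R.
Proof.
suff N1 : abs (- 1 : D) = 1 :> R by rewrite -mulN1r absM N1 mul1r.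
have abs1 : abs (1 : D) = 1 :> R.
  have /abs_gt0 /lt0r_neq0 n1 := oner_neq0 D.
  by apply: (mulfI n1); rewrite -absM !mulr1.
apply/eqP; rewrite -(eqrXn2 (ltn0Sn 1)) ?abs_ge0 // expr1n.
by rewrite expr2 -absM mulrNN mulr1 abs1.
Qed.

Lemma nbhs_absP x (A : set D) :
  nbhs x A <-> exists2 e : R, 0 < e & forall b, abs (x - b) < e -> A b.
Proof.
rewrite -nbhs_entourageE /= abs_entourageE /entourage_; split.
  move=> [E [e /= e0 eE] EA]; exists e => // b xb.
  by apply: EA; apply/xsectionP; apply: eE.
move=> [e e0 eA]; exists [set xy | abs (xy.1 - xy.2) < e]; first by exists e.
by move=> b /xsectionP; apply: eA.
Qed.

(** The inverse of the embedding of the rationals forces it to be injective, and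
its continuity at 0 makes the images of small rationals small. *)
Lemma small_central_scalar (e : R) : 0 < e ->
  exists2 c : D, c != 0 /\ abs c < e & forall z, GRing.comm c z.
Proof.
move=> e0; have [g [ratrK ratr_cont _]] := @ratr_homeo R D.
have ratr0 : ratr 0 = 0 :> D by rewrite /ratr mul0r.
have : nbhs (ratr 0 : D) [set b | abs (0 - b) < e].
  by rewrite ratr0; apply/nbhs_absP; exists e.
move=> /(ratr_cont 0) /nbhs_ballP[/= d d0 dP].
have d2 : 0 < d / 2 by rewrite divr_gt0.
exists (ratr (d / 2)); first split.
- apply: contraTneq d2 => /(congr1 g); rewrite -ratr0 !ratrK => ->.
  by rewrite ltxx.
- rewrite -absN -sub0r; apply: dP.
  by rewrite /ball /= sub0r normrN gtr0_norm // ltr_pdivrMr // ltr_pMr //.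
- move=> z; rewrite /ratr; apply/commr_sym/commrM; last apply: commrV.
    exact: commr_int.
  exact: commr_int.
Qed.

Definition bounded_center_linear K : Prop :=
  center_linear K /\ exists2 C : R, 0 < C & forall z, abs (K z) <= C * abs z.

Lemma additive_sub K : {morph K : a b / a + b} -> {morph K : a b / a - b}.
Proof. by move=> KD a b; apply/(canRL (addrK _)); rewrite -KD subrK. Qed.

Lemma bounded_center_linear_continuous K :
  bounded_center_linear K -> continuous K.
Proof.
move=> [[KD _] [C C0 KC]] x A /nbhs_absP[e e0 eA].
apply/nbhs_absP; exists (e / C); first exact: divr_gt0.
move=> b xb; apply: eA; rewrite -(additive_sub KD).
by apply: le_lt_trans (KC _) _; rewrite mulrC -ltr_pdivlMr.
Qed.

Lemma bounded_center_linear_comp K L :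
  bounded_center_linear K -> bounded_center_linear L ->
  bounded_center_linear (K \o L).
Proof.
move=> [[KD KZ] [C C0 KC]] [[LD LZ] [B B0 LB]]; split; first split.
- by move=> a b /=; rewrite LD KD.
- by move=> c a cC /=; rewrite LZ // KZ.
- exists (C * B); first exact: mulr_gt0.
  by move=> z /=; rewrite (le_trans (KC _)) // -mulrA ler_pM2l.
Qed.

(** The chain rule for a linear outer map: boundedness of [K] is what keeps
[K \o o] negligible when [o] is. *)
Lemma is_gateaux_comp K f x L :
  bounded_center_linear K -> is_gateaux f x L ->
  is_gateaux (K \o f) x (K \o L).
Proof.
move=> Kbl [[LD LZ] [w [w_cont w_small fxE]]].
have [[KD KZ] [C C0 KC]] := Kbl.
split; first split.
- by move=> a b /=; rewrite LD KD.
- by move=> c a cC /=; rewrite LZ // KZ.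
exists (K \o w); split.
- move=> a; apply: continuous_comp; first exact: w_cont.
  exact: bounded_center_linear_continuous.
- apply: (@squeeze_cvgr _ _ _ _ (cst 0) (fun a => C * (abs (w a) / abs a))).
  + apply: nearW => a /=; rewrite divr_ge0 ?abs_ge0 //= mulrA.
    by rewrite ler_wpM2r // invr_ge0 abs_ge0.
  + exact: cvg_cst.
  + rewrite -[X in _ --> X](mulr0 C); apply: cvgM => //; exact: cvg_cst.
- by move=> a /=; rewrite -KD -fxE (additive_sub KD).
Qed.

Lemma little_oP (o : D -> D) (e : R) : 0 < e ->
    (abs (o a) / abs a : R) @[a --> (0 : D)^'] --> (0 : R) ->
  exists2 d : R, 0 < d &
    forall a, a != 0 -> abs a < d -> abs (o a) < e * abs a :> R.
Proof.
move=> e0 /cvgrPdist_lt /(_ _ e0) /nbhs_absP[d d0 dP]; exists d => // a a0 ad.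
have := dP a; rewrite sub0r absN => /(_ ad a0) /=.
rewrite sub0r normrN ger0_norm ?divr_ge0 ?abs_ge0 //.
by rewrite ltr_pdivrMr ?abs_gt0.
Qed.

(** Let [w1] and [w2] be the remainders for [L1] and [L2].  For a central scalar
[c], the equality [c (L1 a - L2 a) = w2 (c a) - w1 (c a)] holds, and the
absolute value of its right side is at most [e |c|] for [c] small; then [|L1 a - L2 a| <= e]. *)
Lemma is_gateaux_unique f x L1 L2 :
  is_gateaux f x L1 -> is_gateaux f x L2 -> L1 = L2.
Proof.
move=> [[_ L1Z] [w1 [_ w1_small f1]]] [[_ L2Z] [w2 [_ w2_small f2]]].
have [L10 L20] : L1 0 = 0 /\ L2 0 = 0.
  have c0 z : GRing.comm 0 z by exact/commr_sym/commr0.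
  by rewrite -(mul0r (0 : D)) L1Z // L2Z // !mul0r.
apply/funext => a; have [->|a0] := eqVneq a 0; first by rewrite L10 L20.
apply/eqP; rewrite -subr_eq0; apply/eqP/abs_eq0/eqP.
rewrite eq_le abs_ge0 andbT; apply/ler_addgt0Pl => e e0; rewrite addr0.
have a_gt0 := abs_gt0 a0.
(* Each of the two remainders at [c a] gets half of [e |c|]. *)
have e'0 : 0 < e / (2 * abs a) by rewrite divr_gt0 // mulr_gt0.
have [d1 d10 d1P] := little_oP e'0 w1_small.
have [d2 d20 d2P] := little_oP e'0 w2_small.
have d0 : 0 < Num.min d1 d2 / abs a by rewrite divr_gt0 // lt_min d10.
have [c [c0 cd] c_central] := small_central_scalar d0.
have c_gt0 := abs_gt0 c0.
have ca0 : c * a != 0.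
  by apply: contraTneq (mulr_gt0 c_gt0 a_gt0) => ca; rewrite -absM ca abs0 ltxx.
have := cd; rewrite ltr_pdivlMr // -absM lt_min.
move=> /andP[/(d1P _ ca0) w1a /(d2P _ ca0) w2a].
have LoE : c * (L1 a - L2 a) = w2 (c * a) - w1 (c * a).
  rewrite mulrBr -L1Z // -L2Z //; apply/eqP.
  by rewrite subr_eq addrAC [_ + L2 _]addrC -f2 f1 addrK.
rewrite -(ler_pM2l c_gt0) -absM LoE (le_trans (abs_leD _ _)) // absN.
rewrite (le_trans (ltW (ltrD w2a w1a))) // absM le_eqVlt; apply/orP; left.
by apply/eqP; have := lt0r_neq0 a_gt0 => ?; field.
Qed.

Lemma gateauxE f x L : is_gateaux f x L -> gateaux f x = L.
Proof.
move=> fL; apply: (is_gateaux_unique _ fL).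
exact: (@xgetPex _ (fun=> 0) [set L | is_gateaux f x L]) (ex_intro _ L fL).
Qed.

Lemma is_gateaux_gateaux f x :
  gateaux_differentiable f -> is_gateaux f x (gateaux f x).
Proof. by move=> /(_ x) [L fL]; rewrite (gateauxE fL). Qed.

(** * Iterated Jordan products *)

Definition jordan a z : D := 2%:R^-1 * (z * a + a * z).

Lemma half_central z : GRing.comm (2%:R^-1 : D) z.
Proof. by apply/commr_sym/commrV/commr_nat. Qed.

Lemma jordan_bounded a : bounded_center_linear (jordan a).
Proof.
split; first split.
- by move=> z1 z2; rewrite /jordan mulrDl (mulrDr a) addrACA mulrDr.
- move=> c z cC; rewrite /jordan (mulrA a) -(cC a) -!mulrA -mulrDr.
  by rewrite !mulrA (half_central c).
- pose m : R := abs (2%:R^-1 : D).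
  have m0 : 0 <= m by exact: abs_ge0.
  (* The [+ 1] keeps the constant positive when [a = 0]. *)
  exists (m * (2 * abs a) + 1).
    by rewrite ltr_wpDl ?mulr_ge0 ?abs_ge0.
  move=> z; rewrite /jordan absM -/m mulrDl mul1r.
  rewrite (le_trans (ler_wpM2l m0 (abs_leD _ _))) // !absM.
  rewrite (_ : abs z * abs a + _ = 2 * abs a * abs z :> R); last ring.
  by rewrite -(mulrA m) lerDl abs_ge0.
Qed.

Lemma foldr_jordan_bounded (h : seq D) :
  bounded_center_linear (fun z => foldr jordan z h).
Proof.
elim: h => [|a h IHh] /=.
  by split; [|exists 1 => // z; rewrite mul1r].
exact: bounded_center_linear_comp (jordan_bounded a) IHh.
Qed.

(** The factors 1/2 are central, so they can be collected in front; what is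
left is a purely ring-theoretic nested product. *)
Lemma foldr_jordanE (z : D) (h : seq D) :
  foldr jordan z h =
    (2%:R ^+ size h)^-1 * foldr (fun a z => a * z + z * a) z h.
Proof.
elim: h => [|a h IHh] /=; first by rewrite expr0 invr1 mul1r.
have cC (u : D) : GRing.comm (2%:R ^+ size h)^-1 u.
  by rewrite -exprVn; apply/commr_sym/commrX/commr_sym/half_central.
rewrite /jordan IHh -!exprVn in cC *.
rewrite exprS (mulrA a) -(cC a) -!mulrA -mulrDr.
by congr (_ * (_ * _)); rewrite addrC.
Qed.

(** A new direction enters next to [y], inside the existing products: this is
why it is appended at the end of the list. *)
Lemma is_gateaux_foldr_jordan (y : D -> D) (h : seq D) x :
    gateaux_differentiable y ->
    (forall x a, gateaux y x a = jordan a (y x)) ->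
  is_gateaux (fun x => foldr jordan (y x) h) x
    (fun a => foldr jordan (y x) (rcons h a)).
Proof.
move=> y_diff y_eq.
have := is_gateaux_comp (foldr_jordan_bounded h) (is_gateaux_gateaux x y_diff).
congr is_gateaux; apply/funext => a /=.
by rewrite foldr_rcons y_eq.
Qed.

Lemma gateauxn_foldr_jordan (y : D -> D) (h : seq D) :
    gateaux_differentiable y ->
    (forall x a, gateaux y x a = jordan a (y x)) ->
  gateauxn y h = fun x => foldr jordan (y x) h.
Proof.
move=> y_diff y_eq; elim/last_ind: h => [//|h a IHh].
rewrite /gateauxn foldl_rcons -/(gateauxn y h) IHh.
apply/funext => x.
by rewrite (gateauxE (is_gateaux_foldr_jordan h x y_diff y_eq)).
Qed.

End AbsoluteValue.

(** * Admissible permutations *)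

(** Conditions (1) and (2) are mirror images of each other: both are this one
property, for the relations of being to the left of and to the right of. *)
Definition inward_ordered {n : nat} (r : rel 'I_n.+1) : bool :=
  [forall i : 'I_n, forall j : 'I_n,
    [&& i != j, r (sym_h i) (sym_h j) & r (sym_h j) (sym_y n)] ==> (i < j)%N].

Lemma inward_orderedP (n : nat) (r : rel 'I_n.+1) :
  reflect (forall i j : 'I_n, i != j -> r (sym_h i) (sym_h j) ->
             r (sym_h j) (sym_y n) -> (i < j)%N)
          (inward_ordered r).
Proof.
apply: (iffP forallP) => [rP i j ij rij rj|rP i].
  by have /forallP /(_ j) /implyP := rP i; apply; apply/and3P.
by apply/forallP => j; apply/implyP => /and3P[]; apply: rP.
Qed.

Definition after {n : nat} (s : 'S_n.+1) : rel 'I_n.+1 :=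
  fun u v => left_of s v u.

Lemma left_orderedE (n : nat) (s : 'S_n.+1) :
  left_ordered s = inward_ordered (left_of s).
Proof. by []. Qed.

Lemma right_orderedE (n : nat) (s : 'S_n.+1) :
  right_ordered s = inward_ordered (after s).
Proof. by []. Qed.

(** Renumbering of the symbols when a new [h_1] is inserted: [y] is kept and
[h_i] becomes [h_(i+1)]. *)
Local Notation lift1 := (lift (sym_h ord0)).

Lemma lift1_y (n : nat) : lift1 (sym_y n) = sym_y n.+1.
Proof. exact/val_inj. Qed.

Lemma lift1_h (n : nat) (i : 'I_n) : lift1 (sym_h i) = sym_h (lift ord0 i).
Proof. exact/val_inj. Qed.

Lemma inward_ordered_outermost (n : nat) (r : rel 'I_n.+2) (i : 'I_n.+1) :
  inward_ordered r -> i != ord0 ->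
  r (sym_h i) (sym_h ord0) -> ~~ r (sym_h ord0) (sym_y n.+1).
Proof.
by move=> /inward_orderedP rP i0 ri; apply/negP => /(rP _ _ i0 ri).
Qed.

(** Having the smallest index, [h_1] can only violate a constraint as the inner
symbol of a pair, which is excluded when no symbol lies beyond it on its side
of [y].  The other constraints do not see [h_1]. *)
Lemma inward_ordered_lift (n : nat) (r : rel 'I_n.+1) (r' : rel 'I_n.+2) :
    (forall u v, r' (lift1 u) (lift1 v) = r u v) ->
    (forall u, r' u (sym_h ord0) -> ~~ r' (sym_h ord0) (sym_y n.+1)) ->
  inward_ordered r' = inward_ordered r.
Proof.
move=> r'E out; apply/inward_orderedP/inward_orderedP => rP i j ij.
  rewrite -!r'E lift1_y !lift1_h => rij rj.
  by have := rP _ _ _ rij rj; rewrite (inj_eq lift_inj); apply.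
case: (unliftP ord0 j) ij => [j' ->|-> _ /out /negP//].
case: (unliftP ord0 i) => [i' -> ij|->//].
rewrite -!lift1_h -lift1_y !r'E => rij rj.
by have := rP _ _ _ rij rj; apply; apply: contra_neq ij => ->.
Qed.

Lemma left_of_lift_perm (n : nat) (p q : 'I_n.+2) (s : 'S_n.+1) u v :
  left_of (lift_perm p q s) (lift q u) (lift q v) = left_of s u v.
Proof. by rewrite /left_of lift_permV !lift_perm_lift /= !ltnNge leq_bump2. Qed.

Lemma place_lift_perm (n : nat) (p q : 'I_n.+2) (s : 'S_n.+1) :
  (lift_perm p q s)^-1%g q = p.
Proof. by rewrite lift_permV lift_perm_id. Qed.

Definition nested {n : nat} (s : 'S_n.+1) : bool :=
  left_ordered s && right_ordered s.

Lemma nested_lift_perm (n : nat) (p : 'I_n.+2) (s : 'S_n.+1) :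
    (p == ord0) || (p == ord_max) ->
  nested (lift_perm p (sym_h ord0) s) = nested s.
Proof.
set s' := lift_perm _ _ _ => p_end.
rewrite /nested !left_orderedE !right_orderedE.
have h1E : s'^-1%g (sym_h ord0) = p by exact: place_lift_perm.
congr andb; apply: inward_ordered_lift => [u v|u];
  rewrite /after ?left_of_lift_perm //; rewrite /left_of h1E.
- case/orP: p_end => /eqP -> //= _.
  by rewrite -leqNgt -ltnS ltn_ord.
- case/orP: p_end => /eqP -> //=.
  by rewrite ltnNge -ltnS ltn_ord.
Qed.

(** Were [h_1] at an interior place, the symbol at the end of the word on the
same side of [y] would be some [h_i] with [i > 1] outside of [h_1]. *)
Lemma nested_place_h1 (n : nat) (s : 'S_n.+2) :
  nested s ->
  (s^-1%g (sym_h ord0) == ord0) || (s^-1%g (sym_h ord0) == ord_max).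
Proof.
move=> /andP[]; rewrite left_orderedE right_orderedE => ls rs.
set p := s^-1%g _; apply/norP => -[p0 pm].
(* A place other than those of [y] and [h_1] carries some [h_i] with [i > 1]. *)
have out (e : 'I_n.+2) : e != s^-1%g (sym_y n.+1) -> e != p ->
    exists2 i : 'I_n.+1, i != ord0 & s e = sym_h i.
  move=> ey ep; case: (unliftP (sym_y n.+1) (s e)) => [i sei|sey].
    exists i => //; apply: contra_neq ep => i0.
    by rewrite /p /sym_h -i0 -sei permK.
  by move: ey; rewrite -sey permK eqxx.
have p_gt0 : (0 < p)%N by rewrite lt0n.
have p_lt : (p < n.+1)%N by rewrite ltn_neqAle -ltnS ltn_ord andbT.
have [py|py] := ltnP p (s^-1%g (sym_y n.+1)).
- have [||i i0 si] := out ord0.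
  + by apply/eqP => /(congr1 val) /= e0; rewrite -e0 in py.
  + by rewrite eq_sym.
  have := inward_ordered_outermost ls i0.
  by rewrite /left_of -si permK py => /(_ p_gt0).
- have [||i i0 si] := out ord_max.
  + by apply/eqP => /(congr1 val) /= e0; rewrite -e0 leqNgt p_lt in py.
  + by rewrite eq_sym.
  have := inward_ordered_outermost rs i0.
  rewrite /after /left_of -si permK => /(_ p_lt) /negP; apply.
  rewrite ltn_neqAle py andbT; apply/eqP => /val_inj /perm_inj.
  by move/(congr1 val).
Qed.

(** Inserting the symbol [q] at place [p]; the inverse erases place [p] and
renumbers. *)
Lemma lift_perm_bij (n : nat) (p q : 'I_n.+1) :
  {on [pred s : 'S_n.+1 | s^-1%g q == p], bijective (lift_perm p q)}.
Proof.
pose del (s : 'S_n.+1) k := odflt k (unlift (s p) (s (lift p k))).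
have delK (s : 'S_n.+1) k : lift (s p) (del s k) = s (lift p k).
  rewrite /del; have: s p != s (lift p k) by rewrite (inj_eq perm_inj) neq_lift.
  by case/unlift_some => ? ? ->.
have del_inj s : injective (del s).
  by move=> k1 k2 /(congr1 (lift (s p))); rewrite !delK => /perm_inj/lift_inj.
exists (fun s => perm (@del_inj s)) => [s _|s /eqP sq].
  by apply/permP => k; rewrite permE /del lift_perm_lift lift_perm_id liftK.
have sp : s p = q by rewrite -sq permKV.
apply/permP => k; case: (unliftP p k) => [k' ->|->]; last first.
  by rewrite lift_perm_id.
by rewrite lift_perm_lift permE -sp delK.
Qed.

Lemma sum_nested_recl (T : nzRingType) (n : nat) (F : 'S_n.+2 -> T) :
  \sum_(s | nested s) F s =
    \sum_(s : 'S_n.+1 | nested s) F (lift_perm ord0 (sym_h ord0) s) +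
    \sum_(s : 'S_n.+1 | nested s) F (lift_perm ord_max (sym_h ord0) s).
Proof.
have at_end p : (p == ord0) || (p == ord_max) ->
    \sum_(s | nested s && (s^-1%g (sym_h ord0) == p)) F s =
    \sum_(s : 'S_n.+1 | nested s) F (lift_perm p (sym_h ord0) s).
  move=> p_end; rewrite (reindex (lift_perm p (sym_h ord0))); last first.
    by apply: subon_bij (lift_perm_bij p _) => s; rewrite !inE => /andP[].
  by apply: eq_bigl => s; rewrite place_lift_perm eqxx andbT nested_lift_perm.
rewrite (bigID (fun s : 'S_n.+2 => s^-1%g (sym_h ord0) == ord0)) /=.
rewrite at_end ?eqxx // -(at_end ord_max) ?eqxx ?orbT //; congr (_ + _).
apply: eq_bigl => s; case: (boolP (nested s)) => //= /nested_place_h1.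
by case: eqP => [->|].
Qed.

(** Expanding the nested product over any ring: [h_1] multiplies the rest on the
left or on the right, as it stands at the first or the last place. *)
Lemma sum_nested (T : nzRingType) (n : nat) (h : n.-tuple T) (y : T) :
  foldr (fun a z => a * z + z * a) y h =
    \sum_(s : 'S_n.+1 | nested s) \prod_(k < n.+1) sym_val y h (s k).
Proof.
elim: n h => [|n IHn] h.
  rewrite tuple0 /=.
  rewrite (eq_bigl predT) => [|s]; last first.
    by apply/andP; split; apply/forallP => -[].
  rewrite (big_pred1 1%g) => [|s]; last first.
    by apply/esym/eqP/permP => i; rewrite !ord1.
  by rewrite big_ord1 perm1 /sym_val unlift_none.
case/tupleP: h => a h; rewrite /= IHn sum_nested_recl.
have val_h1 : sym_val y [tuple of a :: h] (sym_h ord0) = a.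
  by rewrite /sym_val liftK (tnth_nth a).
have val_lift u : sym_val y [tuple of a :: h] (lift1 u) = sym_val y h u.
  rewrite /sym_val; case: (unliftP (sym_y n) u) => [i ->|->].
    by rewrite lift1_h liftK !(tnth_nth a).
  by rewrite lift1_y unlift_none.
rewrite mulr_sumr mulr_suml; congr (_ + _); apply: eq_bigr => s _.
  rewrite [RHS]big_ord_recl lift_perm_id val_h1; congr (_ * _).
  by apply: eq_bigr => k _; rewrite lift_perm_lift val_lift.
rewrite [RHS]big_ord_recr /= lift_perm_id val_h1; congr (_ * _).
apply: eq_bigr => k _.
have -> : widen_ord (leqnSn n.+1) k = lift ord_max k.
  by apply/val_inj; rewrite /= /bump leqNgt ltn_ord.
by rewrite lift_perm_lift val_lift.
Qed.

Theorem theorem11p1 (R : realType) (D : completeDivRingType R) (y : D -> D)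
    (y_diff : gateaux_differentiable y)
    (y_eq : forall x h : D, gateaux y x h = 2%:R^-1 * (y x * h + h * y x))
    (n : nat) :
  gateaux_differentiablen n y /\
  forall (h : n.-tuple D) (x : D),
    gateauxn y h x =
      (2%:R ^+ n)^-1 *
        \sum_(s : 'S_n.+1 | left_ordered s && right_ordered s)
          \prod_(k < n.+1) sym_val (y x) h (s k).
Proof.
split=> [h _ x|h x]; rewrite (gateauxn_foldr_jordan _ y_diff y_eq).
  by eexists; apply: is_gateaux_foldr_jordan.
by rewrite foldr_jordanE size_tuple sum_nested.
Qed.
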